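(* Let $n\geq1$ and $1\leq s\leq n$. The number of $132$-avoiding involutions of length $n$ having exactly $s$ right-to-left maxima is $0$ if $n$ is odd and $s$ is even; $\binom{n-1-s/2}{n/2-1}-\binom{n-1-s/2}{n/2}$ if $n$ and $s$ are both even; and $\binom{n-1-(s-1)/2}{\lfloor n/2\rfloor}$ if $s$ is odd.
   Context: An involution of length $n$ is $\pi\in\mathfrak{S}_n$ with $\pi=\pi^{-1}$ (one-line notation $\pi_1\cdots\pi_n$); it avoids $132$ if there are no $i<j<k$ with $\pi_i<\pi_k<\pi_j$. The entry $\pi_j$ is a right-to-left maximum if $\pi_j>\pi_i$ for all $i$ with $j<i\leq n$. $\lfloor\cdot\rfloor$ is the floor function and $\binom{a}{b}=0$ if $b<0$ or $b>a$. *)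

(* Defs.v *)
From mathcomp Require Import all_boot all_order all_algebra all_fingroup.

Set Implicit Arguments.
Unset Strict Implicit.
Unset Printing Implicit Defensive.

(* A permutation of length n is p : 'S_n; the positions and values 1, ..., n
   of the one-line notation are shifted to 0, ..., n - 1. *)

Definition is_involution n (p : 'S_n) : bool := (p == p^-1)%g.

Definition avoids132 n (p : 'S_n) : bool :=
  ~~ [exists i : 'I_n, exists j : 'I_n, exists k : 'I_n,
        [&& i < j, j < k, p i < p k & p k < p j]].

Definition rl_max n (p : 'S_n) (j : 'I_n) : bool :=
  [forall i : 'I_n, (j < i) ==> (p i < p j)].

Definition nb_rl_max n (p : 'S_n) : nat := #|[set j | rl_max p j]|.

Definition inv132_rl_max n s : {set 'S_n} :=
  [set p | [&& is_involution p, avoids132 p & nb_rl_max p == s]].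

(* Main.v *)
Require Import Defs.
From mathcomp Require Import all_boot all_order all_algebra all_fingroup.
From mathcomp Require Import zify.

(* In a 132-avoiding permutation the entries larger than the first one appear
   in increasing order. Hence a 132-avoiding involution fixing the first
   position is the identity, and any other one arises from a 132-avoiding
   involution q of length n - 2 by inserting a 2-cycle (0 v) such that q is
   increasing to the right of v. If t is the length of the longest increasing
   suffix of q, there are t + 1 choices for v; leaving r <= t entries to the
   right of v gives a permutation with longest increasing suffix r + 1, and it
   creates two new right-to-left maxima if r = 0 and none otherwise. Counting
   the nodes of this generating tree with a given number of steps r = 0 yields
   ballot numbers, and their sum over the identities of length n - 2 i, from
   which the tree grows, telescopes to a binomial coefficient. *)

Set Implicit Arguments.
Unset Strict Implicit.
Unset Printing Implicit Defensive.

(** * Pointwise reformulations and increasing suffixes *)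

Definition increasing_from n (p : 'S_n) (v : nat) : bool :=
  [forall a : 'I_n, forall b : 'I_n, (v <= a) && (a < b) ==> (p a < p b)].

(* The length of the longest increasing suffix, as the number of positions
   from which p is increasing (an up-closed set). *)
Definition inc_suffix n (p : 'S_n) : nat := #|[set a : 'I_n | increasing_from p a]|.

Definition inv132 n : {set 'S_n} := [set p | is_involution p && avoids132 p].

Lemma involutionP n (p : 'S_n) : reflect (forall x, p (p x) = x) (is_involution p).
Proof.
apply: (iffP eqP) => [pV x | pK]; first by rewrite {1}pV permK.
by apply/permP => x; apply: (@perm_inj _ p); rewrite permKV pK.
Qed.

Lemma avoids132P n (p : 'S_n) :
  reflect (forall i j k : 'I_n, i < j -> j < k -> p i < p k -> ~~ (p k < p j))
          (avoids132 p).
Proof.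
apply: (iffP idP) => [/existsPn av i j k ij jk ik | av].
  have /existsPn /(_ j) /existsPn /(_ k) := av i.
  by rewrite ij jk ik.
apply/existsPn => i; apply/existsPn => j; apply/existsPn => k.
by apply/negP => /and4P[ij jk ik]; apply/negP; apply: av ij jk ik.
Qed.

Lemma increasing_fromP n (p : 'S_n) v :
  reflect (forall a b : 'I_n, v <= a -> a < b -> p a < p b) (increasing_from p v).
Proof.
apply: (iffP forallP) => [inc a b va ab | inc a].
  by have /forallP /(_ b) := inc a; rewrite va ab.
by apply/forallP => b; apply/implyP => /andP[]; apply: inc.
Qed.

Lemma increasing_fromW n (p : 'S_n) v w :
  v <= w -> increasing_from p v -> increasing_from p w.
Proof.
move=> vw /increasing_fromP inc; apply/increasing_fromP => a b wa.
exact/inc/(leq_trans vw).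
Qed.

Lemma card_ord_geq n v : #|[set k : 'I_n | v <= k]| = n - v.
Proof.
have [nv|vn] := leqP n v.
  rewrite (eqP (_ : n - v == 0)) ?subn_eq0 //; apply: eq_card0 => k.
  by rewrite inE leqNgt (leq_trans (ltn_ord k) nv).
have eqn : v + (n - v) = n by lia.
rewrite -[RHS]card_ord -(card_imset _ (@rshift_inj v (n - v))).
rewrite -(card_imset _ (@cast_ord_inj _ _ eqn)); apply: eq_card => k.
rewrite inE; apply/idP/imsetP => [vk | [_ /imsetP[j _ ->] ->] /=]; last exact: leq_addr.
have jP : k - v < n - v by have := ltn_ord k; lia.
by exists (rshift v (Ordinal jP)); [exact: imset_f | apply: val_inj => /=; lia].
Qed.

(** The positions from which [q] is increasing form a final segment, so their number decides whether
    [v] is among them; for [v = n] both sides are trivially true. *)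
Lemma leq_inc_suffix n (q : 'S_n) v :
  v <= n -> increasing_from q v = (n - v <= inc_suffix q).
Proof.
move=> vn; apply/idP/idP => [inc | ].
  rewrite -card_ord_geq; apply/subset_leq_card/subsetP => k; rewrite !inE => vk.
  exact: increasing_fromW inc.
apply: contraTT => ninc; rewrite -ltnNge.
have {}vn : v < n.
  rewrite ltn_neqAle vn andbT; apply: contraNneq ninc => ->.
  by apply/increasing_fromP => a b; rewrite leqNgt ltn_ord.
apply: (@leq_ltn_trans (n - v.+1)); last by lia.
rewrite -card_ord_geq; apply/subset_leq_card/subsetP => k; rewrite !inE => inc.
by rewrite ltnNge; apply: contra ninc => kv; apply: increasing_fromW inc.
Qed.

Lemma lift_perm_surj n (p : 'S_n.+1) (i j : 'I_n.+1) :
  p i = j -> exists q, p = lift_perm i j q.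
Proof.
(* The default [k] is never taken: [p] is injective, so only [i] is sent to [j]. *)
move=> pij; pose f k := odflt k (unlift j (p (lift i k))).
have liftf k : lift j (f k) = p (lift i k).
  rewrite /f; case: unliftP => [m ->|/eqP] //=.
  by rewrite -pij (inj_eq perm_inj) eq_sym (negPf (neq_lift _ _)).
have f_inj : injective f.
  by move=> a b eqf; apply/(@lift_inj _ i)/(@perm_inj _ p); rewrite -!liftf eqf.
exists (perm f_inj); apply/permP => x.
case: (unliftP i x) => [k|] ->; last by rewrite lift_perm_id.
by rewrite lift_perm_lift permE liftf.
Qed.

(** * Inserting a 2-cycle through the first position *)

Section InsertTransposition.

Variables (n : nat) (v : 'I_n.+1).

(** The order embedding that skips 0 and [v.+1]; it serves for positions and values alike, as the
    2-cycle occupies the same two of each. *)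
Definition ins_emb (k : 'I_n) : 'I_n.+2 := lift ord0 (lift v k).
(* Inserts the 2-cycle (0 v.+1). *)
Definition ins (q : 'S_n) : 'S_n.+2 :=
  lift_perm ord0 (lift ord0 v) (lift_perm v ord0 q).

Local Notation e := ins_emb.
Local Notation w := (lift ord0 v).

Lemma val_ins_emb k : e k = k.+1 + (v <= k) :> nat.
Proof. by rewrite /= /bump /=; lia. Qed.

Lemma lt_ins_emb a b : (e a < e b) = (a < b).
Proof. by rewrite !val_ins_emb; lia. Qed.

Lemma ins_emb_inj : injective e.
Proof. by move=> a b /lift_inj /lift_inj. Qed.

Lemma lt0_ins_emb k : (ord0 : 'I_n.+2) < e k.
Proof. by rewrite val_ins_emb. Qed.

Lemma gtw_ins_emb k : (w < e k) = (v <= k).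
Proof. by rewrite val_ins_emb /= /bump /=; lia. Qed.

Variant ins_spec (x : 'I_n.+2) : Type :=
  | InsZero of x = ord0
  | InsTop of x = w
  | InsEmb k of x = e k.

Lemma insP x : ins_spec x.
Proof.
case: (unliftP ord0 x) => [y|] ->; last exact: InsZero.
case: (unliftP v y) => [k|] ->; last exact: InsTop.
exact: InsEmb.
Qed.

Lemma ins0 q : ins q ord0 = w.
Proof. exact: lift_perm_id. Qed.

Lemma insw q : ins q w = ord0.
Proof. by rewrite lift_perm_lift lift_perm_id; apply: val_inj. Qed.

Lemma insE q k : ins q (e k) = e (q k).
Proof.
rewrite !lift_perm_lift; apply: val_inj.
by rewrite /= /bump /=; lia.
Qed.

Definition insEs := (ins0, insw, insE).

Lemma ins_inj : injective ins.
Proof.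
move=> p q eqpq; apply/permP => k; apply: ins_emb_inj.
by rewrite -!insE eqpq.
Qed.

Lemma ins_neq1 q : ins q != 1%g.
Proof. by apply/eqP => /permP /(_ ord0); rewrite ins0 perm1. Qed.

Lemma is_involution_ins q : is_involution (ins q) = is_involution q.
Proof.
apply/involutionP/involutionP => qK x.
  by apply: ins_emb_inj; rewrite -!insE.
by case: (insP x) => [|| k] ->; rewrite !insEs // qK.
Qed.

(** The new entries can only start a pattern 132. From [w], of value 0, this takes an inversion of
    [q] among positions from [v] on; from 0, of value [w], one among values from [v] on. An
    involution exchanges the two conditions. *)
Lemma avoids132_ins q : is_involution q ->
  avoids132 (ins q) = avoids132 q && increasing_from q v.
Proof.
move=> /involutionP qK.
apply/avoids132P/andP => [av | [/avoids132P av /increasing_fromP inc]].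
  split; [apply/avoids132P => i j k | apply/increasing_fromP => a b va ab].
    by have := av (e i) (e j) (e k); rewrite !insE !lt_ins_emb.
  have := av w (e a) (e b); rewrite gtw_ins_emb lt_ins_emb !insEs lt0_ins_emb lt_ins_emb.
  move=> /(_ va ab isT); rewrite -leqNgt leq_eqVlt => /orP[/eqP/val_inj/perm_inj ab'|//].
  by rewrite ab' ltnn in ab.
move=> i j k ij jk.
case: (insP j) ij jk => [->|->|a ->]; first by rewrite ltn0.
  by rewrite insw ltn0.
case: (insP k) => [->|->|b ->]; first by rewrite !ltn0.
  by rewrite !insw !ltn0.
case: (insP i) => [|| c] ->; rewrite !insEs !lt_ins_emb ?gtw_ins_emb.
- move=> _ ab vb; apply/negP => ba.
  by have := inc _ _ vb ba; rewrite !qK ltnNge ltnW.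
- by move=> va ab _; have := inc _ _ va ab; lia.
- exact: av.
Qed.

Lemma rl_max_ins_emb q k : rl_max (ins q) (e k) = rl_max q k.
Proof.
apply/forallP/forallP => rlm x.
  by have := rlm (e x); rewrite !insE !lt_ins_emb.
case: (insP x) => [|| a] ->; rewrite !insEs ?lt_ins_emb ?lt0_ins_emb ?implybT //.
Qed.

Lemma rl_max_ins0 q : rl_max (ins q) ord0 = (v == ord_max).
Proof.
apply/forallP/eqP => [rlm | vmax x].
  apply/eqP; rewrite eqE /= eqn_leq -ltnS ltn_ord /= leqNgt; apply/negP => vn.
  (* [x] is the position of the largest value; it would lie to the right of 0. *)
  have := permKV (ins q) ord_max; set x := ((ins q)^-1)%g _ => px.
  have /implyP := rlm x; rewrite px ins0.
  case: (insP x) px => [|| a] ->; rewrite ?insEs => /(congr1 val) /=.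
  - by rewrite /bump /=; lia.
  - by [].
  - by move=> _ /(_ isT); rewrite /bump /= add1n ltnS ltnNge ltnW.
apply/implyP => x0; rewrite ltn_neqAle (inj_eq val_inj) (inj_eq perm_inj).
apply/andP; split; first by apply: contraTneq x0 => ->; rewrite ltnn.
by rewrite ins0 vmax -ltnS.
Qed.

Lemma rl_max_insw q : rl_max (ins q) w = (v == ord_max).
Proof.
apply/forallP/eqP => [rlm | vmax x]; last first.
  by rewrite insw vmax implybE -leqNgt -ltnS /= /bump /= add1n ltn_ord.
apply/eqP; rewrite eqE /= eqn_leq -ltnS ltn_ord /= leqNgt; apply/negP => vn.
by have := rlm ord_max; rewrite insw ltn0 implybF /= /bump /= add1n ltnS vn.
Qed.

Lemma card_ins (P : pred 'I_n.+2) :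
  #|[set x | P x]| = P ord0 + P w + #|[set k | P (e k)]|.
Proof.
rewrite !cardsE -!sum1_card !(big_mkcond P) (big_mkcond [pred k | P (e k)]) /=.
by rewrite (bigD1_ord ord0) // (bigD1_ord v) //= addnA; do 2 case: ifP.
Qed.

Lemma nb_rl_max_ins q : nb_rl_max (ins q) = nb_rl_max q + (v == ord_max).*2.
Proof.
rewrite /nb_rl_max card_ins rl_max_ins0 rl_max_insw addnn addnC; congr (_ + _).
by apply: eq_card => k; rewrite !inE rl_max_ins_emb.
Qed.

(** The value 0 at [w] stops any increasing suffix from starting earlier, so the longest one starts
    exactly at [w]. *)
Lemma inc_suffix_ins q :
  increasing_from q v -> inc_suffix (ins q) = (n - v).+1.
Proof.
move=> /increasing_fromP inc; rewrite /inc_suffix card_ins.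
have not_inc (x : 'I_n.+2) : x < w -> ins q x > 0 -> ~~ increasing_from (ins q) x.
  move=> xw px; apply/negP => /increasing_fromP /(_ x w (leqnn _) xw).
  by rewrite insw ltn0.
have incw : increasing_from (ins q) w.
  apply/increasing_fromP => a b.
  case: (insP b) => [|| l] ->; rewrite ?ltn0 //.
    by move=> wa aw; have := leq_trans aw wa; rewrite ltnn.
  case: (insP a) => [|| k] ->; rewrite ?insEs ?lt0_ins_emb //.
  move=> wk; rewrite !lt_ins_emb; apply: inc.
  rewrite -gtw_ins_emb ltn_neqAle wk andbT.
  by apply/eqP => /val_inj /lift_inj /eqP; rewrite (negPf (neq_lift _ _)).
rewrite (negPf (not_inc _ _ _)) ?ins0 // incw add0n -card_ord_geq add1n; congr _.+1.
apply: eq_card => k; rewrite !inE; case: (leqP v k) => [vk | kv].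
  by apply: increasing_fromW incw; rewrite ltnW ?gtw_ins_emb.
apply/negbTE/not_inc; last by rewrite insE lt0_ins_emb.
by rewrite val_ins_emb /= /bump /=; lia.
Qed.

End InsertTransposition.

(** * The identity and the decomposition of the other involutions *)

Lemma increasing_involution_id n (p : 'S_n) :
  is_involution p -> {homo p : a b / a < b} -> p = 1%g.
Proof.
move=> /involutionP pK inc; apply/permP => x; rewrite perm1; apply: val_inj.
case: (ltngtP (p x) x) => // lt; have := inc _ _ lt; rewrite pK => lt'.
  by have := ltn_trans lt lt'; rewrite ltnn.
by have := ltn_trans lt lt'; rewrite ltnn.
Qed.

Lemma inv132_1 n : 1%g \in inv132 n.
Proof.
rewrite inE; apply/andP; split; first by apply/involutionP => x; rewrite !perm1.
by apply/avoids132P => i j k _ jk _; rewrite !perm1 -leqNgt ltnW.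
Qed.

Lemma inc_suffix1 n : inc_suffix (1%g : 'S_n) = n.
Proof.
rewrite /inc_suffix -[RHS]subn0 -card_ord_geq; apply: eq_card => k; rewrite !inE.
by apply/increasing_fromP => a b _; rewrite !perm1.
Qed.

Lemma nb_rl_max1 n : nb_rl_max (1%g : 'S_n) = (0 < n).
Proof.
case: n => [|n]; first by apply: eq_card0 => -[].
rewrite /nb_rl_max /= -(cards1 (ord_max : 'I_n.+1)); apply: eq_card => k; rewrite !inE.
apply/forallP/eqP => [rlm | -> x]; last by rewrite implybE -leqNgt -ltnS ltn_ord.
apply: val_inj; apply/eqP; rewrite eqn_leq -ltnS ltn_ord leqNgt; apply/negP => kn.
by have /implyP /(_ kn) := rlm ord_max; rewrite !perm1 ltnNge ltnW.
Qed.

Lemma inv132_insP n (p : 'S_n.+2) :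
  reflect (exists v : 'I_n.+1,
             exists2 q, (q \in inv132 n) && increasing_from q v & p = ins v q)
          ((p \in inv132 n.+2) && (p != 1%g)).
Proof.
apply: (iffP andP) => [[] | [v [q /andP[]]]]; last first.
  rewrite inE => /andP[qi qa] qv ->; rewrite inE is_involution_ins ins_neq1.
  by rewrite avoids132_ins // qi qa qv.
rewrite inE => /andP[pi pa] p1.
case: (unliftP ord0 (p ord0)) => [v|] p0; last first.
  (* If [p] fixes 0, this entry would start a 132 with any later inversion, so [p] is increasing. *)
  case/eqP: p1; apply: increasing_involution_id => // a b ab.
  have gt0 (x : 'I_n.+2) : (ord0 : 'I_n.+2) < x = (x != ord0).
    by rewrite lt0n -(inj_eq val_inj).
  have pb0 : (ord0 : 'I_n.+2) < p b.
    by rewrite gt0 -[X in _ != X]p0 (inj_eq perm_inj) -gt0 (leq_ltn_trans _ ab).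
  have [->|a0] := eqVneq a ord0; first by rewrite p0.
  move/avoids132P: pa => /(_ ord0 a b); rewrite p0 gt0 => /(_ a0 ab pb0).
  rewrite -leqNgt leq_eqVlt => /orP[/eqP/val_inj/perm_inj ab'|//].
  by rewrite ab' ltnn in ab.
have [q1 defp] := lift_perm_surj p0.
(* The involution sends [p ord0] back to 0, so the other half of the 2-cycle can be deleted too. *)
have q1v : q1 v = ord0.
  apply: (@lift_inj _ (lift ord0 v)); rewrite -(lift_perm_lift ord0) -defp -[in LHS]p0.
  by rewrite (involutionP _ pi); apply: val_inj.
have [q defq] := lift_perm_surj q1v.
have {q1 q1v defp defq} defp : p = ins v q by rewrite defp defq.
exists v, q => //; move: pi pa; rewrite defp is_involution_ins => qi.
by rewrite avoids132_ins // inE qi.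
Qed.

(** One generation of the tree, for arbitrary [f] so that it can be iterated with [nb_desc s i] as
    weight. *)
Lemma sum_inv132 n (f : nat -> nat -> nat) :
  \sum_(p in inv132 n.+2) f (inc_suffix p) (nb_rl_max p) =
  f n.+2 1 + \sum_(q in inv132 n) \sum_(r < (inc_suffix q).+1)
                f r.+1 (nb_rl_max q + (r == 0 :> nat).*2).
Proof.
rewrite (bigD1 1%g) ?inv132_1 //= inc_suffix1 nb_rl_max1; congr (_ + _).
pose A := [set x : 'I_n.+1 * 'S_n | (x.2 \in inv132 n) && increasing_from x.2 x.1].
pose h (x : 'I_n.+1 * 'S_n) := ins x.1 x.2.
have h_inj : {in A &, injective h}.
  move=> [v q] [v' q'] _ _; rewrite /h /= => eqi.
  have /(congr1 (fun s : 'S__ => s ord0)) := eqi; rewrite !ins0 => /lift_inj eqv.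
  by rewrite eqv in eqi *; rewrite (ins_inj eqi).
rewrite (eq_bigl (mem (h @: A))) => [|p]; last first.
  apply/inv132_insP/imsetP => [[v [q qP ->]] | [[v q]]].
    by exists (v, q) => //; rewrite inE.
  by rewrite inE => qP ->; exists v, q.
rewrite big_imset //=.
rewrite (eq_bigl (fun x : 'I_n.+1 * 'S_n =>
  (x.2 \in inv132 n) && increasing_from x.2 x.1)) => [|x]; last by rewrite inE.
rewrite -(pair_big_dep xpredT
  (fun (v : 'I_n.+1) (q : 'S_n) => (q \in inv132 n) && increasing_from q v)
  (fun v q => f (inc_suffix (ins v q)) (nb_rl_max (ins v q)))) /=.
rewrite (exchange_big_dep (mem (inv132 n))) => [|v q _ /andP[]] //=.
apply: eq_bigr => q qi.
rewrite (eq_bigl (fun v : 'I_n.+1 => n - v <= inc_suffix q)); last first.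
  by move=> v; rewrite qi leq_inc_suffix // -ltnS.
rewrite (eq_bigr (fun v : 'I_n.+1 =>
  f (n - v).+1 (nb_rl_max q + (n - v == 0).*2))); last first.
  move=> v; rewrite -leq_inc_suffix => [qv|]; last by rewrite -ltnS.
  rewrite inc_suffix_ins // nb_rl_max_ins; congr (f _ (_ + _.*2)).
  by rewrite -(inj_eq val_inj) /= subn_eq0 eqn_leq -ltnS ltn_ord.
(* Reversal turns [v] into [r = n - v], the number of entries to the right of [w]. *)
rewrite (reindex_inj rev_ord_inj) /=.
have lesuf : (inc_suffix q).+1 <= n.+1 by rewrite ltnS -[X in _ <= X]card_ord max_card.
rewrite [RHS](big_ord_widen _ (fun r => f r.+1 (nb_rl_max q + (r == 0).*2)) lesuf).
apply: eq_big => [v | v _]; have -> : n - (n.+1 - v.+1) = v by have := ltn_ord v; lia.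
  by rewrite ltnS.
by [].
Qed.

(** * Counting by generations of the tree *)

(* The number of nodes with s right-to-left maxima that lie i generations below
   a node with longest increasing suffix t and s' right-to-left maxima. *)
Fixpoint nb_desc (s i t s' : nat) : nat :=
  if i is j.+1 then \sum_(r < t.+1) nb_desc s j r.+1 (s' + (r == 0 :> nat).*2)
  else s' == s.

Lemma nb_descS0 s i s' : nb_desc s i.+1 0 s' = nb_desc s i 1 s'.+2.
Proof. by rewrite /= big_ord1 addn2. Qed.

(** Raising [t] by one adds a single child; the sum thus becomes a two-term recursion suited to
    Pascal's rule. *)
Lemma nb_descSS s i t s' :
  nb_desc s i.+1 t.+1 s' = nb_desc s i.+1 t s' + nb_desc s i t.+2 s'.
Proof. by rewrite /= big_ord_recr /= addn0. Qed.

Lemma card_inv132_rl_max n s :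
  #|inv132_rl_max n s| = \sum_(p in inv132 n) nb_desc s 0 (inc_suffix p) (nb_rl_max p).
Proof.
rewrite -sum1_card big_mkcond [RHS]big_mkcond; apply: eq_bigr => p _.
by rewrite !inE andbA /=; case: (_ && _) (_ == _) => [] [].
Qed.

Lemma sum_nb_desc_inv132 s i n :
  \sum_(p in inv132 n.+2) nb_desc s i (inc_suffix p) (nb_rl_max p) =
  nb_desc s i n.+2 1
  + \sum_(q in inv132 n) nb_desc s i.+1 (inc_suffix q) (nb_rl_max q).
Proof. exact: sum_inv132. Qed.

Lemma inv132_small n : n <= 1 -> inv132 n = [set 1%g].
Proof.
case: n => [|[|//]] _; apply/setP => p.
all: have -> : p = 1%g by apply/permP => x; rewrite perm1 ?[p x]ord1 ?[x]ord1 //; case: x.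
all: by rewrite inv132_1 set11.
Qed.

(** Peeling off generations leaves the identities of length [n - i.*2] as roots. The empty one
    stands apart, having no right-to-left maximum instead of one. *)
Lemma card_inv132_rl_maxE n s :
  #|inv132_rl_max n s| = \sum_(i < uphalf n) nb_desc s i (n - i.*2) 1
                         + (~~ odd n) * nb_desc s n./2 0 0.
Proof.
rewrite card_inv132_rl_max.
suff main m (b : bool) i :
    \sum_(p in inv132 (b + m.*2)) nb_desc s i (inc_suffix p) (nb_rl_max p)
  = \sum_(j < b + m) nb_desc s (i + j) (b + m.*2 - j.*2) 1
    + ~~ b * nb_desc s (i + m) 0 0.
  have := main n./2 (odd n) 0; rewrite odd_double_half => ->.
  by rewrite uphalf_half.
elim: m b i => [|m IHm] b i.
  rewrite inv132_small; last by case: b.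
  rewrite big_set1 inc_suffix1 nb_rl_max1.
  by case: b; rewrite /= ?big_ord1 ?big_ord0 /= ?mul1n ?addn0.
rewrite doubleS !addnS sum_nb_desc_inv132 IHm big_ord_recl /= addn0 addnA.
congr (_ + _ + _).
by apply: eq_bigr => j _; rewrite /bump add1n addnS doubleS !subSS.
Qed.

(** Here and in the next two lemmas: each step adds 0 or 2 right-to-left maxima. *)
Lemma nb_desc_lt s i t s' : s < s' -> nb_desc s i t s' = 0.
Proof.
elim: i t s' => [|i IHi] t s' ss' /=; first by rewrite gtn_eqF.
by rewrite big1 // => r _; apply: IHi; rewrite (leq_trans ss') ?leq_addr.
Qed.

Lemma nb_desc_gt s i t s' : s' + i.*2 < s -> nb_desc s i t s' = 0.
Proof.
elim: i t s' => [|i IHi] t s' ss' /=; first by rewrite ltn_eqF // -[s']addn0.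
by rewrite big1 // => r _; apply: IHi; case: eqP => _; lia.
Qed.

Lemma nb_desc_parity s i t s' : odd s != odd s' -> nb_desc s i t s' = 0.
Proof.
elim: i t s' => [|i IHi] t s' ss' /=.
  by apply/eqP; rewrite eqb0; apply: contraNneq ss' => ->.
by rewrite big1 // => r _; apply: IHi; rewrite oddD odd_double addbF.
Qed.

(** Every step must be [r = 0], so exactly one path remains. *)
Lemma nb_desc_ballot0 k t s' : nb_desc (s' + k.*2) k t s' = 1.
Proof.
elim: k t s' => [|k IHk] t s'; first by rewrite /= addn0 eqxx.
elim: t => [|t IHt]; first by rewrite nb_descS0 doubleS -!addSnnS IHk.
by rewrite nb_descSS IHt nb_desc_gt ?addn0 //; lia.
Qed.

(* A ballot number, with the subtracted term moved to the left; the parameters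
   k and l count the steps r = 0 and the steps r > 0 (here l.+1 of the latter). *)
Lemma nb_desc_ballot l k t s' :
  nb_desc (s' + k.*2) (k + l.+1) t s' + 'C(k + l.*2 + t.+1, l)
  = 'C(k + l.*2 + t.+1, l.+1).
Proof.
(* For [k = t = 0] the forced step [r = 0] overshoots the target, and the two binomials agree by
   symmetry. *)
have start l1 s1 : nb_desc (s1 + 0.*2) (0 + l1.+1) 0 s1 + 'C(0 + l1.*2 + 1, l1)
                   = 'C(0 + l1.*2 + 1, l1.+1).
  rewrite nb_descS0 nb_desc_lt ?addn0 // !add0n -[in RHS]bin_sub; last by lia.
  by congr 'C(_, _); lia.
have next l1 k1 s1 : (forall s2, nb_desc (s2 + k1.*2) (k1 + l1.+1) 1 s2
    + 'C(k1 + l1.*2 + 2, l1) = 'C(k1 + l1.*2 + 2, l1.+1)) ->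
  nb_desc (s1 + k1.+1.*2) (k1.+1 + l1.+1) 0 s1 + 'C(k1.+1 + l1.*2 + 1, l1)
    = 'C(k1.+1 + l1.*2 + 1, l1.+1).
  move=> /(_ s1.+2); rewrite addSn nb_descS0.
  have -> : s1 + k1.+1.*2 = s1.+2 + k1.*2 by lia.
  by have -> : k1.+1 + l1.*2 + 1 = k1 + l1.*2 + 2 by lia.
have pascal a b N m : a + 'C(N, m.+1) = 'C(N, m.+2) -> b + 'C(N, m) = 'C(N, m.+1) ->
    a + b + 'C(N.+1, m.+1) = 'C(N.+1, m.+2).
  by rewrite !binS; lia.
elim: l k t s' => [|l IHl]; elim=> [|k IHk]; elim=> [|t IHt] s'; try exact: start.
all: try by apply: next => s2; apply: IHk.
1,2: have := IHt s'; rewrite !addn1 nb_descSS nb_desc_ballot0 !bin1; lia.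
(* The two terms of [nb_descSS] are the cases [(l.+1, t)] and [(l, t.+2)], whose binomials share
   their upper index. *)
all: rewrite [_ + l.+2]addnS nb_descSS [_ + t.+2]addnS.
all: apply: pascal; first by rewrite -[(_ + l.+1).+1]addnS; apply: IHt.
  by rewrite (_ : _ + t.+1 = 0 + l.*2 + t.+3); [apply: IHl | lia].
by rewrite (_ : _ + t.+1 = k.+1 + l.*2 + t.+3); [apply: IHl | lia].
Qed.

(** Terms with [i < k] vanish and the term [i = k] is 1. The later ones are differences of
    neighbouring binomials, all with upper index [n - 1 - k], so the sum telescopes. *)
Lemma sum_nb_desc k n l : (k + l).*2 < n ->
  \sum_(i < (k + l).+1) nb_desc k.*2.+1 i (n - i.*2) 1 = 'C(n - 1 - k, l).
Proof.
elim: l => [|l IHl] lt_n.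
  rewrite addn0 in lt_n *; rewrite big_ord_recr /= big1 ?add0n => [|i _].
    by rewrite bin0 -add1n nb_desc_ballot0.
  by apply: nb_desc_gt; have := ltn_ord i; lia.
rewrite addnS big_ord_recr /= IHl; last by lia.
have := nb_desc_ballot l k (n - (k + l).+1.*2) 1; rewrite add1n addnS.
rewrite (_ : k + _ + _ = n - 1 - k) => [|]; last by lia.
by rewrite addnC.
Qed.

(** * The three parity cases *)

Theorem theorem4p4 (n s : nat) (hn : 1 <= n) (hs1 : 1 <= s) (hsn : s <= n) :
  [/\ odd n -> ~~ odd s -> #|inv132_rl_max n s| = 0,
      ~~ odd n -> ~~ odd s ->
        (#|inv132_rl_max n s|%:Z =
           'C(n - 1 - s %/ 2, n %/ 2 - 1)%:Z - 'C(n - 1 - s %/ 2, n %/ 2)%:Z)%R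
    & odd s ->
        #|inv132_rl_max n s| = 'C(n - 1 - (s - 1) %/ 2, n %/ 2)].
Proof.
have even_sum : ~~ odd s -> \sum_(i < uphalf n) nb_desc s i (n - i.*2) 1 = 0.
  by move=> s_even; rewrite big1 // => i _; apply: nb_desc_parity; rewrite (negPf s_even).
split=> [n_odd s_even | n_even s_even | s_odd]; rewrite card_inv132_rl_maxE.
- by rewrite even_sum // n_odd.
- rewrite even_sum // n_even mul1n add0n.
  have [k def_s] : exists k, s = k.+1.*2 by exists s./2.-1; lia.
  have [l def_n] : exists l, n = (k.+1 + l).*2 by exists (n./2 - k.+1); lia.
  have -> : n - 1 - s %/ 2 = k + l.*2 by lia.
  have -> : n %/ 2 - 1 = k + l by lia.
  have -> : n %/ 2 = (k + l).+1 by lia.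
  have -> : n./2 = (k + l).+1 by lia.
  (* Only the empty root contributes; its single child has two right-to-left maxima and suffix
     length 1. *)
  rewrite nb_descS0 def_s doubleS -[_.+2]add0n -!addSnnS.
  case: l {def_n} => [|l].
    by rewrite addn0 nb_desc_ballot0 binn bin_small.
  have := nb_desc_ballot l k 1 2.
  have -> : 'C(k + l.*2 + 2, l.+1) = 'C(k + l.+1.*2, k + l.+1).
    by rewrite -bin_sub; [congr 'C(_, _); lia | lia].
  have -> : 'C(k + l.*2 + 2, l) = 'C(k + l.+1.*2, (k + l.+1).+1).
    by rewrite -bin_sub; [congr 'C(_, _); lia | lia].
  lia.
- have [k def_s] : exists k, s = k.*2.+1 by exists s./2; lia.
  have -> : ~~ odd n * nb_desc s n./2 0 0 = 0.
    by rewrite (@nb_desc_parity s _ _ 0) ?s_odd // muln0.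
  have [l def_n] : exists l, uphalf n = (k + l).+1 by exists (uphalf n - k.+1); lia.
  rewrite addn0 def_n def_s sum_nb_desc; last by lia.
  have -> : (k.*2.+1 - 1) %/ 2 = k by lia.
  by rewrite -bin_sub; [congr 'C(_, _); lia | lia].
Qed.
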